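(* Let $\alpha\in(0,1]$ and let $\tilde\Phi\in C^{2,\alpha}_{\rm loc}(\mathbb H)$ be rearrangement invariant, so that it is the lift of a function $\Phi:\mathcal P_2(\mathbb R^d)\to\mathbb R$, i.e. $\tilde\Phi(x)=\Phi(\mu)$ whenever $\mu$ is the law of $x$; assume $\Phi\in C^2(\mathcal P_2(\mathbb R^d))$. If for $x\in\mathbb H$ with law $\mu$ the identity $$\nabla^2\tilde\Phi(x)(h,h_* )=\int_\Omega D_q\big(\nabla_w\Phi(\mu)\big)(x(\omega))\,h(\omega)\cdot h_*(\omega)\,d\omega+\int_{\Omega^2}\nabla^2_{ww}\Phi(\mu)\big(x(\omega),x(\omega_* )\big)h(\omega)\cdot h_*(\omega_* )\,d\omega\,d\omega_*$$ holds for all $h,h_*\in\mathbb H$, then $D_q\big(\nabla_w\Phi(\mu)\big)$ is a constant function on $\mathrm{spt}(\mu)$.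
   Context: $\Omega=(0,1)^d$ with Lebesgue measure $\mathcal L^d_\Omega$, $\mathbb H=L^2(\Omega;\mathbb R^d)$; the law of $x\in\mathbb H$ is $x_\sharp\mathcal L^d_\Omega$. $\tilde\Phi$ is rearrangement invariant if $\tilde\Phi(x)=\tilde\Phi(y)$ whenever $x,y$ have the same law. $C^{2,\alpha}_{\rm loc}(\mathbb H)$: twice continuously Fréchet differentiable with Hessian $\nabla^2\tilde\Phi$ $\alpha$-Hölder on every ball of $\mathbb H$. $\mathcal P_2(\mathbb R^d)$: Borel probability measures with finite second moment, with the Wasserstein distance $W_2$; $T_\mu\mathcal P_2(\mathbb R^d)$ is the closure of $\{D\varphi:\varphi\in C_c^\infty(\mathbb R^d)\}$ in $L^2(\mu)$. The Wasserstein gradient $\nabla_w\Phi(\mu)\in T_\mu\mathcal P_2(\mathbb R^d)$ satisfies $\nabla\tilde\Phi(x)=\nabla_w\Phi(\mu)\circ x$ for $x$ with law $\mu$. For $\Phi\in C^2(\mathcal P_2(\mathbb R^d))$ (twice continuously differentiable in the Wasserstein sense), $D_q(\nabla_w\Phi(\mu)):\mathrm{spt}(\mu)\to\mathbb R^{d\times d}$ is the (continuous) derivative of $q\mapsto\nabla_w\Phi(\mu)(q)$ and $\nabla^2_{ww}\Phi(\mu):\mathrm{spt}(\mu)^2\to\mathbb R^{d\times d}$ is the Wasserstein Hessian (the Wasserstein gradient of $\mu\mapsto\nabla_w\Phi(\mu)(q)$); for such $\Phi$ the displayed identity always holds when $h=\xi\circ x$, $h_*=\xi_*\circ x$ with $\xi,\xi_*\in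 T_\mu\mathcal P_2(\mathbb R^d)$. *)

(* Defs.v *)
From HB Require Import structures.
From mathcomp Require Import all_boot all_order all_algebra.
From mathcomp Require Import ring_quotient generic_quotient.
From mathcomp Require Import all_classical all_reals all_analysis measurable_realfun.
From mathcomp Require Import ring lra.

Set Implicit Arguments.
Unset Strict Implicit.
Unset Printing Implicit Defensive.

Import Order.TTheory GRing.Theory Num.Theory.
Import numFieldNormedType.Exports.

Local Open Scope classical_set_scope.
Local Open Scope ring_scope.
Local Open Scope quotient_scope.

Section unit_cube.
Variable R : realType.
Local Notation RM := (measurableTypeR R).

(* Lebesgue measure restricted to ]0, 1[. *)
Definition unit_itv : set RM -> \bar R :=
  mrestr lebesgue_measure (measurable_itv `]0, 1[).

HB.instance Definition _ := Measure.on unit_itv.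

Lemma unit_itv_setT : unit_itv [set: _] = 1%E.
Proof.
by rewrite /unit_itv /mrestr setTI lebesgue_measure_itv/= lte_fin ltr01 oppr0 adde0.
Qed.

HB.instance Definition _ :=
  Measure_isProbability.Build _ _ R unit_itv unit_itv_setT.

Section prod.
Context d1 d2 (T1 : measurableType d1) (T2 : measurableType d2).
Variables (P : probability T1 R) (Q : probability T2 R).

Definition prodP : set (T1 * T2) -> \bar R := (P \x Q)%E.
HB.instance Definition _ := Measure.on prodP.
Lemma prodP_setT : prodP [set: _] = 1%E.
Proof.
rewrite /prodP -setXTT [LHS]product_measure1E//.
rewrite [X in (X * _)%E]probability_setT [X in (_ * X)%E]probability_setT.
by rewrite mule1.
Qed.
HB.instance Definition _ := Measure_isProbability.Build _ _ R prodP prodP_setT.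
End prod.

Definition tuple_cons n (z : RM * n.-tuple RM) : n.+1.-tuple RM :=
  [tuple of z.1 :: z.2].

Lemma measurable_tuple_cons n : measurable_fun [set: RM * n.-tuple RM] (@tuple_cons n).
Proof. exact: measurable_cons. Qed.

HB.instance Definition _ n :=
  isMeasurableFun.Build _ _ _ _ (@tuple_cons n) (@measurable_tuple_cons n).

(* Lebesgue measure on (0,1)^n, as a measure on all of R^n concentrated on the
   open cube: the n-fold product of [unit_itv]; see [cube_box]. *)
Fixpoint cube n : probability (n.-tuple RM) R :=
  match n with
  | 0 => \d_[tuple]
  | m.+1 => distribution (prodP unit_itv (cube m)) (@tuple_cons m)
  end.

Lemma measurable_box n (A : 'I_n -> set RM) : (forall i, measurable (A i)) ->
  measurable [set t : n.-tuple RM | forall i, A i (tnth t i)].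
Proof.
move=> mA.
rewrite (_ : [set t | _] =
    ~` \bigcup_(i in [set: 'I_n]) ((@tnth n RM)^~ i @^-1` ~` A i)); last first.
  apply/seteqP; split => t /=; first by move=> At -[i _]; apply; exact: At.
  by move=> At i; apply: contrapT => Ai; apply: At; exists i.
apply/measurableC/fin_bigcup_measurable; first exact: finite_finset.
move=> i _; rewrite -[X in measurable X]setTI.
by apply: measurable_tnth => //; exact/measurableC.
Qed.

Lemma cube_box n (A : 'I_n -> set RM) : (forall i, measurable (A i)) ->
  cube n [set t | forall i, A i (tnth t i)] = (\prod_(i < n) unit_itv (A i))%E.
Proof.
elim: n A => [|n IH] A mA.
  rewrite big_ord0 /= diracE mem_set// => -[] //.
rewrite big_ord_recl /= -(IH (fun i => A (lift ord0 i)))//.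
rewrite -product_measure1E//; last first.
  by apply: (@measurable_box n (fun i => A (lift ord0 i))) => i; exact: mA.
congr ((_ \x _)%E _); apply/seteqP; split => -[a t] /=.
  move=> At; split; first by have := At ord0.
  by move=> i; have := At (lift ord0 i); rewrite tnthS.
move=> [Aa At] i; case: (unliftP ord0 i) => [j ->|->].
  by rewrite tnthS; exact: At.
by [].
Qed.
End unit_cube.

Section euclidean.
Variables (R : realType) (d : nat).
Implicit Types u v : 'I_d -> R.

Lemma lagrange u v :
  (\sum_i u i ^+ 2) * (\sum_i v i ^+ 2) - (\sum_i u i * v i) ^+ 2 =
  2^-1 * \sum_i \sum_j (u i * v j - u j * v i) ^+ 2.
Proof.
have E : \sum_i \sum_j (u i * v j - u j * v i) ^+ 2 =
   \sum_i \sum_j u i ^+ 2 * v j ^+ 2 + \sum_i \sum_j u j ^+ 2 * v i ^+ 2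
   - 2 * \sum_i \sum_j (u i * v i) * (u j * v j).
  rewrite mulr_sumr -big_split -sumrB /=; apply: eq_bigr => i _.
  rewrite mulr_sumr -big_split -sumrB /=; apply: eq_bigr => j _; ring.
rewrite E [X in _ + X - _]exchange_big /=.
by rewrite expr2 !big_distrlr /=; field.
Qed.

Lemma euclid_triangle u v :
  Num.sqrt (\sum_i (u i + v i) ^+ 2) <=
  Num.sqrt (\sum_i u i ^+ 2) + Num.sqrt (\sum_i v i ^+ 2).
Proof.
have s0 w : 0 <= \sum_(i < d) (w i : R) ^+ 2 by apply: sumr_ge0 => i _; exact: sqr_ge0.
set a := \sum_i u i ^+ 2; set b := \sum_i v i ^+ 2; set c := \sum_i u i * v i.
have cs : c <= Num.sqrt a * Num.sqrt b.
  rewrite -sqrtrM ?s0//; apply: le_trans (ler_norm _) _.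
  rewrite -sqrtr_sqr ler_sqrt ?mulr_ge0 ?s0// -subr_ge0 lagrange.
  by rewrite mulr_ge0// sumr_ge0// => i _; rewrite sumr_ge0// => j _; exact: sqr_ge0.
rewrite -[leRHS]ger0_norm ?addr_ge0 ?sqrtr_ge0// -sqrtr_sqr ler_sqrt ?sqr_ge0//.
rewrite sqrrD !sqr_sqrtr ?s0//.
have -> : \sum_i (u i + v i) ^+ 2 = a + c *+ 2 + b.
  rewrite /a /b /c -sumrMnl -!big_split /=; apply: eq_bigr => i _.
  by rewrite sqrrD.
by rewrite lerD2r lerD2l lerMn2r cs orbT.
Qed.
End euclidean.

Section L2.
Variables (R : realType) (d : nat).
Local Notation RM := (measurableTypeR R).
Local Notation P := (cube R d).

(* Representatives: d-tuples of square-integrable real functions. *)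
Definition L2fun : Type := {ffun 'I_d -> LfunType P (lee1n 2)}.
HB.instance Definition _ := GRing.Lmodule.on L2fun.

Definition null_L2fun : {pred L2fun} :=
  [pred x : L2fun | `[< forall i, x i = cst 0 %[ae P] >]].

Lemma null_L2fun_zmod : zmod_closed null_L2fun.
Proof.
split.
  apply/asboolP => i.
  by apply: filterE => w _ /=; rewrite ffunE.
move=> x y /asboolP nx /asboolP ny; apply/asboolP => i.
move: (nx i) (ny i); apply: filterS2 => w /= xw yw wT.
have -> : (x - y) i = x i - y i by rewrite !ffunE.
transitivity (x i w - y i w); first by [].
by rewrite (xw wT) (yw wT) subr0.
Qed.
HB.instance Definition _ := GRing.isZmodClosed.Build _ null_L2fun null_L2fun_zmod.

Lemma null_L2funZ (a : R) (x : L2fun) :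
  x \in null_L2fun -> a *: x \in null_L2fun.
Proof.
move=> /asboolP nx; apply/asboolP => i.
move: (nx i); apply: filterS => w /= xw wT.
have -> : (a *: x) i = a *: x i by rewrite !ffunE.
transitivity (a * x i w); first by [].
by rewrite (xw wT) mulr0.
Qed.

(* L^2((0,1)^d; R^d): representatives modulo equality almost everywhere. *)
Definition L2 : Type := Quotient.quot null_L2fun.
HB.instance Definition _ := GRing.Zmodule.on L2.
HB.instance Definition _ := EqQuotient.on L2.

Lemma L2_repr_pi (x : L2fun) : repr (\pi_L2 x) - x \in null_L2fun.
Proof. by rewrite Quotient.idealrBE reprK. Qed.

Lemma pi_L2_eq (x y : L2fun) : x - y \in null_L2fun -> \pi_L2 x = \pi_L2 y.
Proof. by rewrite Quotient.idealrBE => /eqP. Qed.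

Definition scale_L2 (a : R) (x : L2) : L2 := \pi_L2 (a *: repr x).

Lemma pi_L2D (x y : L2fun) : \pi_L2 (x + y) = \pi_L2 x + \pi_L2 y.
Proof. by rewrite !piE. Qed.

Lemma pi_L2Z a (x : L2fun) : scale_L2 a (\pi_L2 x) = \pi_L2 (a *: x).
Proof.
apply: pi_L2_eq; rewrite -scalerBr; apply: null_L2funZ; exact: L2_repr_pi.
Qed.

Fact scale_L2A a b x : scale_L2 a (scale_L2 b x) = scale_L2 (a * b) x.
Proof. by rewrite -[x]reprK (pi_L2Z b) (pi_L2Z a) pi_L2Z scalerA. Qed.
Fact scale_L2_1 : left_id 1 scale_L2.
Proof. by move=> x; rewrite -[x]reprK !pi_L2Z scale1r. Qed.
Fact scale_L2Dr : right_distributive scale_L2 +%R.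
Proof.
move=> a x y; rewrite -[x]reprK -[y]reprK.
by rewrite -pi_L2D !pi_L2Z -pi_L2D scalerDr.
Qed.
Fact scale_L2Dl x : {morph scale_L2^~ x : a b / a + b}.
Proof. by move=> a b; rewrite -[x]reprK !pi_L2Z -pi_L2D scalerDl. Qed.

HB.instance Definition _ := GRing.Zmodule_isLmodule.Build R L2
  scale_L2A scale_L2_1 scale_L2Dr scale_L2Dl.


Let nrm (f : LfunType P (lee1n 2)) : R := fine ('N[P]_2%:E[EFin \o f])%E.

Let nrmD f g : nrm (f + g) <= nrm f + nrm g.
Proof. exact: ler_LnormD. Qed.

Let nrmZ a f : nrm (a *: f) = `|a| * nrm f.
Proof.
by rewrite /nrm [X in fine X = _](LnormZ f a) -finite_norm_fine -EFinM.
Qed.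

Let nrm_ge0 f : 0 <= nrm f.
Proof. by rewrite fine_ge0// Lnorm_ge0. Qed.

Let nrm0 (f : LfunType P (lee1n 2)) : f = cst 0 %[ae P] -> nrm f = 0.
Proof.
move=> f0.
rewrite /nrm unlock.
rewrite (_ : (\int[P]_x _)%E = (\int[P]_x (cst 0 x))%E).
  by rewrite integral0 poweR0r// invr_eq0.
apply: ae_eq_integral => //.
  apply: (measurableT_comp (measurable_poweR _)).
  by apply: measurableT_comp => //; exact/measurable_EFinP.
move: f0; apply: filterS => w /= fw wT.
by rewrite (fw wT) normr0 powR0.
Qed.

(* sqrt (\int |x|^2) for the Euclidean norm |.| on R^d, written coordinatewise;
   the default norm of the library on 'rV[R]_d is the sup norm. *)
Definition norm_L2fun (x : L2fun) : R :=
  Num.sqrt (\sum_i (fine ('N[P]_2%:E[EFin \o x i])%E) ^+ 2).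

Let norm_L2funE x : norm_L2fun x = Num.sqrt (\sum_i (nrm (x i)) ^+ 2).
Proof. by []. Qed.

Lemma norm_L2funD x y : norm_L2fun (x + y) <= norm_L2fun x + norm_L2fun y.
Proof.
rewrite !norm_L2funE.
apply: le_trans (euclid_triangle (fun i => nrm (x i)) (fun i => nrm (y i))).
apply: ler_wsqrtr; apply: ler_sum => i _.
have -> : (x + y) i = x i + y i by rewrite !ffunE.
by rewrite lerXn2r ?nnegrE ?addr_ge0 ?nrm_ge0.
Qed.

Lemma norm_L2funZ a x : norm_L2fun (a *: x) = `|a| * norm_L2fun x.
Proof.
rewrite !norm_L2funE -sqrtr_sqr -sqrtrM ?sqr_ge0// mulr_sumr.
congr Num.sqrt; apply: eq_bigr => i _.
have -> : (a *: x) i = a *: x i by rewrite !ffunE.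
by rewrite nrmZ exprMn real_normK ?num_real.
Qed.

Lemma norm_L2fun_null x : x \in null_L2fun -> norm_L2fun x = 0.
Proof.
move=> /asboolP nx; rewrite norm_L2funE big1 ?sqrtr0// => i _.
by rewrite (nrm0 (nx i)) expr0n.
Qed.

Lemma norm_L2fun_eq0 x : norm_L2fun x = 0 -> x \in null_L2fun.
Proof.
move=> /eqP; rewrite norm_L2funE sqrtr_eq0 => x0.
apply/asboolP => i; apply: (@fine_Lnormr_eq0 _ _ _ P _ (lee1n 2)).
have /eqP : \sum_i nrm (x i) ^+ 2 = 0.
  by apply/eqP; rewrite eq_le x0 sumr_ge0// => j _; exact: sqr_ge0.
rewrite psumr_eq0 => [|j _]; last exact: sqr_ge0.
by move=> /allP/(_ i (mem_index_enum i)); rewrite sqrf_eq0 => /eqP.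
Qed.

Definition norm_L2 (x : L2) : R := norm_L2fun (repr x).

Lemma norm_L2_pi (x : L2fun) : norm_L2 (\pi_L2 x) = norm_L2fun x.
Proof.
have h y z : y - z \in null_L2fun -> norm_L2fun y <= norm_L2fun z.
  move=> yz; rewrite -[y](subrK z) (le_trans (norm_L2funD _ _))//.
  by rewrite norm_L2fun_null// add0r.
apply/eqP; rewrite eq_le !h ?L2_repr_pi//.
by rewrite -opprB rpredN L2_repr_pi.
Qed.

Fact norm_L2D x y : norm_L2 (x + y) <= norm_L2 x + norm_L2 y.
Proof.
by rewrite -[x]reprK -[y]reprK -pi_L2D !norm_L2_pi norm_L2funD.
Qed.

Fact norm_L2Z a x : norm_L2 (a *: x) = `|a| * norm_L2 x.
Proof.
rewrite -[x]reprK [a *: _]pi_L2Z !norm_L2_pi; exact: norm_L2funZ.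
Qed.

Fact norm_L2_eq0 x : norm_L2 x = 0 -> x = 0.
Proof.
move=> /norm_L2fun_eq0 x0; rewrite -[x]reprK.
have -> : 0 = \pi_L2 (0 : L2fun) by rewrite !piE.
by apply: pi_L2_eq; rewrite subr0.
Qed.

HB.instance Definition _ :=
  Lmodule_isNormed.Build R L2 norm_L2D norm_L2Z norm_L2_eq0.

(* An element of L^2 as a function, through its canonical representative: what
   follows uses it only up to almost everywhere equality. *)
Definition L2_fun (x : L2) (w : d.-tuple RM) : 'rV[R]_d := \row_i (repr x) i w.
End L2.

Section frechet.
Variables (R : realType) (V : normedModType R).
Implicit Types (F : V -> R) (x y h k : V).

(* For fixed k, the derivative in direction h of y |-> DF(y)k: this is the
   second Frechet derivative of F at x, as a bilinear form, as soon as F is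
   twice Frechet differentiable. *)
Definition hess F x h k : R := 'd (fun y => 'd F y k) x h.

(* [C2_bounded] and [C2_diff2] say that the map DF : V -> V* is Frechet
   differentiable at x with derivative h |-> hess F x h, for the operator norm
   on V*; additivity and homogeneity of hess in k follow from [C2_diff2]. *)
Record C2alpha_loc (alpha : R) F : Prop := {
  C2_diff : forall x, differentiable F x ;
  C2_bounded : forall x, exists C : R, forall h k,
    `|hess F x h k| <= C * `|h| * `|k| ;
  C2_diff2 : forall x (e : R), 0 < e -> \forall h \near (0 : V), forall k,
    `|'d F (x + h) k - 'd F x k - hess F x h k| <= e * `|h| * `|k| ;
  C2_continuous : forall x (e : R), 0 < e -> \forall y \near x, forall h k,
    `|hess F y h k - hess F x h k| <= e * `|h| * `|k| ;
  C2_holder : forall x0 (r : R), 0 < r -> exists C : R,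
    forall x y, ball x0 r x -> ball x0 r y -> forall h k,
      `|hess F x h k - hess F y h k| <= C * `|x - y| `^ alpha * `|h| * `|k| }.
End frechet.

Section borel.
Variables (R : realType) (d : nat).
(* The Borel sigma-algebra of R^d. *)
HB.instance Definition _ :=
  @isMeasurable.Build (sigma_display (@open 'rV[R]_d)) 'rV[R]_d
    <<s @open 'rV[R]_d >> (@sigma_algebra0 _ setT _) (@sigma_algebraC _ _)
    (@sigma_algebra_bigcup _ setT _).
End borel.

Section wasserstein.
Variables (R : realType) (d : nat).
Local Notation Rd := 'rV[R]_d.

Definition dotv (u v : Rd) : R := \sum_i u 0 i * v 0 i.

Record P2 := MkP2 {
  P2_prob :> probability Rd R ;
  P2_moment : (\int[P2_prob]_q (dotv q q)%:E < +oo)%E }.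

Implicit Types (mu nu : P2) (gamma : probability (Rd * Rd)%type R).

Definition coupling mu nu gamma : Prop := forall A, measurable A ->
  pushforward gamma fst A = mu A /\ pushforward gamma snd A = nu A.

Definition cost gamma : \bar R :=
  (\int[gamma]_z (dotv (z.1 - z.2) (z.1 - z.2))%:E)%E.

Definition W2sq mu nu : \bar R :=
  ereal_inf [set cost gamma | gamma in coupling mu nu].

Definition W2 mu nu : R := Num.sqrt (fine (W2sq mu nu)).

Definition optimal mu nu gamma : Prop :=
  coupling mu nu gamma /\ cost gamma = W2sq mu nu.

Definition spt (mu : set Rd -> \bar R) : set Rd :=
  [set q | forall V, open V -> V q -> (0 < mu V)%E].

Definition partial (i : 'I_d) (phi : Rd -> R) (q : Rd) : R :=
  'D_(delta_mx 0 i) phi q.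

Fixpoint Ck k (phi : Rd -> R) : Prop :=
  match k with
  | 0 => continuous phi
  | k'.+1 => (forall q, differentiable phi q) /\ forall i, Ck k' (partial i phi)
  end.

(* C_c^oo(R^d). *)
Definition test_function (phi : Rd -> R) : Prop :=
  (forall k, Ck k phi) /\
  exists2 K : set Rd, compact K & forall q, ~ K q -> phi q = 0.

Definition egrad (phi : Rd -> R) (q : Rd) : Rd := \row_i partial i phi q.

(* Membership (of the mu-class of xi) in T_mu P_2, the closure in L^2(mu) of
   the gradients of test functions. *)
Definition tangent mu (xi : Rd -> Rd) : Prop :=
  [/\ measurable_fun [set: Rd] xi,
      (\int[mu]_q (dotv (xi q) (xi q))%:E < +oo)%E &
      forall e : R, 0 < e -> exists2 phi, test_function phi &
        (\int[mu]_q (dotv (xi q - egrad phi q) (xi q - egrad phi q))%:E < e%:E)%E].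

(* xi is (a version of) the Wasserstein gradient of U at mu:
   U(nu) - U(mu) = \int xi(q).(p - q) dgamma(q,p) + o(W_2(mu,nu)), uniformly over
   the optimal couplings gamma of mu and nu. *)
Definition wgradient (U : P2 -> R) mu (xi : Rd -> Rd) : Prop :=
  tangent mu xi /\
  forall e : R, 0 < e -> exists2 delta : R, 0 < delta &
    forall nu gamma, W2 mu nu < delta -> optimal mu nu gamma ->
      `|U nu - U mu - \int[gamma]_z dotv (xi z.1) (z.2 - z.1)|
        <= e * W2 mu nu.

(* Joint continuity, W_2 in the measure and the norm in the point, on the set
   of the (mu, q) with q in spt mu. *)
Definition spt_continuous (V : normedModType R) (f : P2 -> Rd -> V) : Prop :=
  forall mu q, spt mu q -> forall e : R, 0 < e ->
    exists2 delta : R, 0 < delta &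
      forall nu p, spt nu p -> W2 mu nu < delta -> `|p - q| < delta ->
        `|f nu p - f mu q| < e.

Definition spt2_continuous (V : normedModType R) (f : P2 -> Rd -> Rd -> V) : Prop :=
  forall mu q q', spt mu q -> spt mu q' -> forall e : R, 0 < e ->
    exists2 delta : R, 0 < delta &
      forall nu p p', spt nu p -> spt nu p' -> W2 mu nu < delta ->
        `|p - q| < delta -> `|p' - q'| < delta ->
        `|f nu p p' - f mu q q'| < e.

(* [gradw mu] is a version of the Wasserstein gradient of Phi at mu, defined on
   all of R^d so that it can be differentiated at points of spt mu and so that
   nu |-> gradw nu q makes sense for measures nu not charging q. D_q(gradw mu) is
   [jacobian (gradw mu)] and [hessw mu q q'] is the Wasserstein Hessian; on the
   supports, the joint continuity makes both independent of the version.
   Vectors are rows: a matrix M acts by v |-> v *m M, jacobian f q is the matrix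
   of v |-> D_v f q, and row k of [hessw mu q q'] is the Wasserstein gradient, at
   the point q', of the k-th component of nu |-> gradw nu q. *)
Record C2_P2 (Phi : P2 -> R) (gradw : P2 -> Rd -> Rd)
    (hessw : P2 -> Rd -> Rd -> 'M[R]_d) : Prop := {
  C2_gradw : forall mu, wgradient Phi mu (gradw mu) ;
  C2_gradw_cont : spt_continuous gradw ;
  C2_Dq : forall mu q, spt mu q -> differentiable (gradw mu) q ;
  C2_Dq_cont : spt_continuous (fun mu => jacobian (gradw mu)) ;
  C2_hessw : forall mu q k, spt mu q ->
    wgradient (fun nu => gradw nu q 0 k) mu (fun q' => row k (hessw mu q q')) ;
  C2_hessw_cont : spt2_continuous hessw }.

Local Notation P := (cube R d).
Local Notation H := (L2 R d).

Definition law (x : H) : set Rd -> \bar R := pushforward P (L2_fun x).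

Definition has_law (x : H) (mu : set Rd -> \bar R) : Prop :=
  forall A, measurable A -> mu A = law x A.

Definition rearrangement_invariant (F : H -> R) : Prop :=
  forall x y, has_law y (law x) -> F x = F y.

Definition lift_of (F : H -> R) (Phi : P2 -> R) : Prop :=
  forall x mu, has_law x mu -> F x = Phi mu.

(* The integrals are over the preimage D of spt mu, where the integrands are
   defined; D has full measure when mu is the law of x. The identity includes
   the convergence of the two integrals. *)
Definition hess_identity (F : H -> R) (gradw : P2 -> Rd -> Rd)
    (hessw : P2 -> Rd -> Rd -> 'M[R]_d) (x : H) mu : Prop :=
  forall h h' : H,
  let X := L2_fun x in
  let D := X @^-1` spt mu in
  let f w := dotv (L2_fun h w *m jacobian (gradw mu) (X w)) (L2_fun h' w) in
  let g z := dotv (L2_fun h z.1 *m hessw mu (X z.1) (X z.2)) (L2_fun h' z.2) in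
  [/\ P.-integrable D (EFin \o f),
      (P \x P)%E.-integrable (D `*` D) (EFin \o g) &
      hess F x h h' = \int[P]_(w in D) f w + \int[(P \x P)%E]_(z in D `*` D) g z].
End wasserstein.

(* Main.v *)
(* Let q1 <> q2 be points of the support of mu. Since Lebesgue measure has no
   atoms, there are disjoint sets A1, A2 of the same small measure eps on which
   x is close to q1, resp. q2. Let x' be x with the values on A1 and A2 replaced
   by q1 and q2, and x'' be x with the values on A1 and A2 replaced by q2 and q1.
   The functions x' + v 1_A1 and x'' + v 1_A2 have the same law for every
   constant vector v, so the Hessian at x' on the fields e_i 1_A1, e_j 1_A1
   equals the Hessian at x'' on e_i 1_A2, e_j 1_A2. Both x' and x'' are close to
   x, so by continuity of the Hessian the corresponding values at x differ by
   o(1) times the product of the norms, that is by o(eps). By the identity these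
   two values are eps D_q(q1)_ij + o(eps) and eps D_q(q2)_ij + o(eps): the double
   integral only contributes O(eps^2). Dividing by eps gives the claim. *)
Require Import Defs.
From HB Require Import structures.
From mathcomp Require Import all_boot all_order all_algebra ring_quotient generic_quotient.
From mathcomp Require Import all_classical all_reals all_analysis measurable_realfun.
From mathcomp Require Import ring lra.

Set Implicit Arguments.
Unset Strict Implicit.
Unset Printing Implicit Defensive.

Import Order.TTheory GRing.Theory Num.Theory.
Import numFieldNormedType.Exports.
Local Open Scope classical_set_scope.
Local Open Scope ring_scope.

(** * Measurability of maps into R^d with its Borel sigma-algebra *)

Section borel_rV.
Variables (R : realType) (d : nat).
Local Notation Rd := 'rV[R]_d.

Lemma rV_ballP (q p : Rd) (e : R) : 0 < e ->
  ball q e p <-> forall i, `|q 0 i - p 0 i| < e.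
Proof.
move=> e0; split=> [[_ B] i|B]; first exact: B.
by split=> // i j; rewrite (ord1 i); exact: B.
Qed.

(** Balls of row vectors are for the sup norm, so these are open cubes with rational centres. Their
    index type is countable and they form a base of the topology. *)
Definition rat_ball (c : 'rV[rat]_d * nat) : set Rd :=
  ball (map_mx ratr c.1 : Rd) (c.2.+1%:R^-1).

Lemma rat_ball_sub (V : set Rd) (q : Rd) : open V -> V q ->
  exists2 c, rat_ball c `<=` V & rat_ball c q.
Proof.
move=> oV Vq.
have /nbhs_ballP[e /= e0 qeV] := open_nbhs_nbhs (conj oV Vq).
(* A cube of radius below [e / 2] whose centre is within that radius of [q] stays in the ball of
   radius [e] about [q]. *)
have [n ne] : exists n : nat, n.+1%:R^-1 < e / 2.
  have e20 : 0 < e / 2 by rewrite divr_gt0.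
  have /cvgrPdist_lt/(_ _ e20)[n _ /(_ n (leqnn n))] := @cvg_harmonic R.
  rewrite sub0r normrN ger0_norm ?harmonic_ge0// => H; by exists n.
have n0 : (0 : R) < n.+1%:R^-1 by rewrite invr_gt0.
have rq (i : 'I_d) : exists r : rat, `|ratr r - q 0 i| < n.+1%:R^-1.
  have [|r /itvP H] := @rat_in_itvoo R (q 0 i - n.+1%:R^-1) (q 0 i + n.+1%:R^-1).
    by rewrite ltrD2l (lt_trans _ n0)// oppr_lt0.
  by exists r; rewrite ltr_distl !H.
have [r rP] := choice rq.
exists (\row_i r i, n).
  move=> p /(rV_ballP _ _ n0) B; apply: qeV; apply/rV_ballP => // i.
  have := B i; have := rP i; rewrite !mxE/= => B1 B2.
  rewrite (_ : q 0 i - p 0 i = (ratr (r i) - p 0 i) - (ratr (r i) - q 0 i)); last by ring.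
  apply: (le_lt_trans (ler_normB _ _)); rewrite (splitr e).
  by apply: ltrD; apply: (lt_trans _ ne); [exact: B2|exact: B1].
by apply/rV_ballP => // i; rewrite !mxE.
Qed.

Lemma open_measurable_rV (V : set Rd) : open V -> measurable V.
Proof. by move=> oV; exact: sub_sigma_algebra. Qed.

Context {dT} {T : measurableType dT}.

Lemma measurable_preimage_ball (f : T -> Rd) (q : Rd) (e : R) : 0 < e ->
  (forall i, measurable_fun [set: T] (fun w => f w 0 i)) ->
  measurable (f @^-1` ball q e).
Proof.
move=> e0 mf.
rewrite (_ : _ @^-1` _ =
   \bigcap_(i in [set: 'I_d]) ((fun w => f w 0 i) @^-1` ball (q 0 i) e)).
  apply: fin_bigcap_measurable; first exact: finite_finset.
  move=> i _; rewrite -[X in measurable X]setTI; apply: mf => //.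
  exact: measurable_ball.
apply/seteqP; split=> w /=; first by move=> /(rV_ballP _ _ e0) B i _; exact: B.
by move=> B; apply/(rV_ballP _ _ e0) => i; exact: B.
Qed.

(** The sigma-algebra is generated by the open sets, not by the coordinates. But an open set is a
    countable union of rational cubes, and the preimage of a cube is a finite intersection of
    coordinate preimages. *)
Lemma measurable_fun_rV (f : T -> Rd) :
  (forall i, measurable_fun [set: T] (fun w => f w 0 i)) ->
  measurable_fun [set: T] f.
Proof.
move=> mf; apply: (@measurability _ _ _ _ _ _ (@open Rd)) => //.
move=> _ [V oV <-]; rewrite setTI.
rewrite (_ : f @^-1` V = \bigcup_c
   (if `[< rat_ball c `<=` V >] then f @^-1` rat_ball c else set0)).
  apply: countable_bigcupT_measurable => // c.
  by case: asboolP => // _; apply: measurable_preimage_ball.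
apply/seteqP; split=> w /=.
  move=> Vw; have [c cV cw] := rat_ball_sub oV Vw; exists c => //.
  by case: asboolP.
by move=> [c _]; case: asboolP => // cV; exact: cV.
Qed.
End borel_rV.

(** * The support of a law has full measure *)

Section spt_full.
Variables (R : realType) (d : nat).
Context {dT} {T : measurableType dT}.
Variable P : probability T R.
Variables (f : T -> 'rV[R]_d) (mu : set 'rV[R]_d -> \bar R).
Hypothesis mf : forall i, measurable_fun [set: T] (fun w => f w 0 i).
Hypothesis lf : forall A, measurable A -> mu A = P (f @^-1` A).

Let null c := if `[< mu (rat_ball c) = 0%E >] then f @^-1` rat_ball c else set0.

(** A point outside the support has an open neighbourhood of measure zero, which contains a rational
    cube around the point. The complement is thus a countable union of null sets. *)
Let sptC : ~` (f @^-1` spt mu) = \bigcup_c null c.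
Proof.
apply/seteqP; split=> w /=.
  move=> /existsNP[V] /not_implyP[oV /not_implyP[Vw /negP]].
  rewrite lt0e negb_and negbK => V0.
  (* As [mu] is a mere set function here, nonnegativity, and monotonicity below, come from [P]
     through [lf]. *)
  have {}V0 : mu V = 0%E.
    move: V0; rewrite lf ?measure_ge0 ?orbF; first by move/eqP.
    exact: open_measurable_rV.
  have [c cV cw] := rat_ball_sub oV Vw; exists c => //; rewrite /null.
  case: asboolP => //; case.
  have mc : measurable (rat_ball c : set 'rV[R]_d).
    by apply: open_measurable_rV; exact: ball_open.
  have mV := open_measurable_rV oV.
  have mF (A : set 'rV[R]_d) : measurable A -> measurable (f @^-1` A).
    by move=> mA; rewrite -[X in measurable X]setTI; apply: measurable_fun_rV.
  apply/eqP; rewrite eq_le; rewrite lf// in V0; apply/andP; split.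
    by rewrite lf// -V0 le_measure ?inE//; [exact: mF|exact: mF|move=> u; exact: cV].
  by rewrite lf.
move=> [c _]; rewrite /null; case: asboolP => // c0 cw sw.
have /(_ (ball_open _ _) cw) := sw (rat_ball c); rewrite c0 ltxx; exact.
Qed.

Lemma measurable_preimage_spt : measurable (f @^-1` spt mu).
Proof.
rewrite -[X in measurable X]setCK sptC; apply: measurableC.
apply: countable_bigcupT_measurable => // c; rewrite /null.
by case: asboolP => // _; apply: measurable_preimage_ball.
Qed.

Lemma preimage_sptC0 : P (~` (f @^-1` spt mu)) = 0%E.
Proof.
apply/negligibleP; first exact/measurableC/measurable_preimage_spt.
rewrite sptC.
(* The union is reindexed by natural numbers, to apply countable subadditivity. *)
have /countable_bijP[B /ppcard_eqP[g]] : countable [set: 'rV[rat]_d * nat] by [].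
rewrite (reindex_bigcup g^-1%FUN setT)//=; last exact: (@subl_surj _ _ B).
rewrite bigcup_mkcond; apply: negligible_bigcup => k; case: ifPn => // _.
  rewrite /null; case: asboolP => // c0; last exact: negligible_set0.
  apply/negligibleP; first exact: measurable_preimage_ball.
  rewrite -c0; apply/esym/lf; apply: open_measurable_rV; exact: ball_open.
exact: negligible_set0.
Qed.
End spt_full.

(** * Almost everywhere calculus with classes in L^2 *)

Section L2_representatives.
Variables (R : realType) (d : nat).
Local Notation P := (cube R d).
Local Notation T := (d.-tuple (measurableTypeR R)).
Local Open Scope quotient_scope.
Implicit Types (u v : L2 R d) (x : L2fun R d).

Lemma measurable_L2_fun u i : measurable_fun [set: T] (fun w => L2_fun u w 0 i).
Proof. by rewrite /L2_fun; under eq_fun do rewrite mxE; exact: measurable_funPT. Qed.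

Lemma ae_all_ord (Q : 'I_d -> T -> Prop) :
  (forall i, {ae P, forall w, Q i w}) -> {ae P, forall w, forall i, Q i w}.
Proof.
move=> aeQ; have : {ae P, forall w, forall i, i \in index_enum 'I_d -> Q i w}.
  elim: (index_enum 'I_d) => [|i s IH]; first exact: aeW.
  move: (aeQ i) IH; apply: filterS2 => w Qi IH j.
  by rewrite inE => /orP[/eqP->|/IH].
by apply: filterS => w H i; exact/H/mem_index_enum.
Qed.

Lemma null_L2fun_ae (x y : L2fun R d) : x - y \in @null_L2fun R d ->
  {ae P, forall w, forall i, x i w = y i w}.
Proof.
move=> /asboolP xy; apply: ae_all_ord => i.
move: (xy i); apply: filterS => w /(_ Logic.I).
have -> : (x - y) i = x i - y i by rewrite !ffunE.
by move=> /eqP; rewrite [X in X == _](_ : _ = x i w - y i w)// subr_eq0 => /eqP.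
Qed.

Lemma L2_fun_pi x : {ae P, forall w, L2_fun (\pi_(L2 R d) x) w = \row_i x i w}.
Proof.
move: (null_L2fun_ae (L2_repr_pi x)); apply: filterS => w H.
by apply/rowP => i; rewrite !mxE H.
Qed.

Lemma L2_funD u v :
  {ae P, forall w, L2_fun (u + v) w = L2_fun u w + L2_fun v w}.
Proof.
have E : u + v = \pi_(L2 R d) (repr u + repr v) by rewrite pi_L2D !reprK.
move: (L2_fun_pi (repr u + repr v)); rewrite -E; apply: filterS => w ->.
by apply/rowP => i; rewrite !mxE !ffunE.
Qed.

Lemma L2_funZ (a : R) u : {ae P, forall w, L2_fun (a *: u) w = a *: L2_fun u w}.
Proof.
move: (L2_fun_pi (a *: repr u)); apply: filterS => w E.
rewrite [in LHS](_ : a *: u = \pi_(L2 R d) (a *: repr u))// E.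
by apply/rowP => i; rewrite !mxE !ffunE.
Qed.

Lemma Lnorm2_bounded (f : T -> R) (A : set T) (K : R) : 0 <= K ->
  measurable A -> measurable_fun [set: T] f ->
  (forall w, `|f w| <= K * \1_A w) ->
  ('N[P]_2%:E[EFin \o f] <= (K * Num.sqrt (fine (P A)))%:E)%E.
Proof.
move=> K0 mA mf fK; rewrite unlock.
have -> : (K * Num.sqrt (fine (P A)))%:E = (((K ^+ 2)%:E * P A) `^ 2^-1)%E.
  rewrite -[in RHS](@fineK _ (P A)) ?fin_num_measure// -EFinM poweR_EFin.
  rewrite powR12_sqrt ?mulr_ge0 ?sqr_ge0 ?fine_ge0// sqrtrM ?sqr_ge0//.
  by rewrite sqrtr_sqr ger0_norm.
apply: gt0_ler_poweR; rewrite ?invr_ge0//.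
- by rewrite in_itv/= leey andbT integral_ge0.
- by rewrite in_itv/= leey andbT mule_ge0 ?lee_fin ?sqr_ge0.
have -> : P A = (\int[P]_w (\1_A w)%:E)%E by rewrite integral_indic// setIT.
rewrite -ge0_integralZl//; last first.
- by rewrite lee_fin sqr_ge0.
- by apply/measurable_EFinP.
apply: ge0_le_integral => //.
- by move=> w _; exact: poweR_ge0.
- apply: (measurableT_comp (measurable_poweR _)).
  by apply: measurableT_comp => //; exact/measurable_EFinP.
- apply: measurable_funeM; exact/measurable_EFinP.
- move=> w _ /=; rewrite powR_mulrn// lee_fin.
  apply: (@le_trans _ _ ((K * \1_A w) ^+ 2)).
    by rewrite lerXn2r// ?nnegrE ?mulr_ge0.
  by rewrite exprMn ler_wpM2l ?sqr_ge0// indicE; case: (_ \in _); rewrite ?expr0n ?expr1n.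
Qed.

(** Constructs the class of an explicit bounded map carried by [A]. Each of the [d] coordinates has
    norm at most [K] times the root of [P A]; summing the squares gives the factor
    [Num.sqrt d%:R]. *)
Lemma L2_of_bounded (f : T -> 'rV[R]_d) (A : set T) (K : R) : 0 <= K ->
  measurable A -> (forall i, measurable_fun [set: T] (fun w => f w 0 i)) ->
  (forall w i, `|f w 0 i| <= K * \1_A w) ->
  exists u, {ae P, forall w, L2_fun u w = f w} /\
    `|u| <= Num.sqrt d%:R * K * Num.sqrt (fine (P A)).
Proof.
move=> K0 mA mf fK.
have N i := Lnorm2_bounded K0 mA (mf i) (fun w => fK w i).
have Lf i : (fun w => f w 0 i) \in Lfun P 2%:E.
  apply/andP; split; first by rewrite inE; exact: mf.
  by rewrite inE /= /finite_norm; apply: le_lt_trans (N i) (ltry _).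
pose x : L2fun R d := [ffun i => Lfun_Sub (lee1n 2) (Lf i)].
exists (\pi_(L2 R d) x); split.
  move: (L2_fun_pi x); apply: filterS => w ->.
  by apply/rowP => i; rewrite !mxE ffunE.
rewrite [`|_|](_ : _ = norm_L2 (\pi_(L2 R d) x))// norm_L2_pi /norm_L2fun.
rewrite -mulrA; set c := K * _.
have c0 : 0 <= c by rewrite mulr_ge0 ?sqrtr_ge0.
rewrite -[c]ger0_norm// -sqrtr_sqr -sqrtrM// ler_wsqrtr//.
rewrite -[leRHS](_ : \sum_(i < d) c ^+ 2 = _); last first.
  by rewrite sumr_const card_ord mulr_natl.
apply: ler_sum => i _; rewrite lerXn2r ?nnegrE ?fine_ge0 ?Lnorm_ge0// ffunE.
rewrite -lee_fin fineK; first exact: N.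
by rewrite ge0_fin_numE ?Lnorm_ge0//; apply: le_lt_trans (N i) (ltry _).
Qed.

(** Replaces the canonical representative by an explicit map when a law is computed: the indicators
    of the two preimages agree almost everywhere. *)
Lemma law_ae u (f : T -> 'rV[R]_d) (B : set 'rV[R]_d) :
  (forall i, measurable_fun [set: T] (fun w => f w 0 i)) -> measurable B ->
  {ae P, forall w, L2_fun u w = f w} -> law u B = P (f @^-1` B).
Proof.
move=> mf mB uf; rewrite /law /pushforward.
have mX (g : T -> 'rV[R]_d) : (forall i, measurable_fun [set: T] (fun w => g w 0 i)) ->
    measurable (g @^-1` B).
  by move=> mg; rewrite -[X in measurable X]setTI; apply: measurable_fun_rV.
have mU := mX _ (measurable_L2_fun u); have mF := mX _ mf.
have PE (X : set T) : measurable X -> P X = (\int[P]_w (\1_X w)%:E)%E.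
  by move=> mX'; rewrite integral_indic// setIT.
rewrite !PE//.
apply: ae_eq_integral => //; [exact/measurable_EFinP|exact/measurable_EFinP|].
move: uf; apply: filterS => w E _; rewrite /= !indicE; congr (_%:R%:E).
by apply: congr1; apply/idP/idP => /set_mem /= H; apply/mem_set; rewrite /= ?E// -E.
Qed.
End L2_representatives.

(** * Equality of Hessians from equality of values on two-parameter families *)

Section hess_transport.
Variables (R : realType) (V : normedModType R).
Implicit Types (x y h k : V).

Lemma small_scale h h' (A B : set V) : nbhs 0 A -> nbhs 0 B ->
  exists2 s : R, 0 < s & A (s *: h) /\ B (s *: h').
Proof.
move=> A0 B0.
have /nbhs_normP[r /= r0 rAB] : nbhs 0 (A `&` B) by exact: filterI.
have n0 : 0 < 1 + `|h| + `|h'|.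
  by rewrite -addrA ltr_pwDl// addr_ge0.
have sn (u : V) : `|u| < 1 + `|h| + `|h'| ->
    (A `&` B) ((r / (1 + `|h| + `|h'|)) *: u).
  move=> u1; apply: rAB; rewrite /ball_ /= sub0r normrN normrZ.
  rewrite ger0_norm ?divr_ge0 ?ltW//.
  by rewrite mulrAC ltr_pdivrMr// ltr_pM2l.
exists (r / (1 + `|h| + `|h'|)); first by rewrite divr_gt0.
have h0 := normr_ge0 h; have h0' := normr_ge0 h'.
by split; [have [] // := sn h | have [] // := sn h']; lra.
Qed.

(** Both sides are the derivative at 0 of the same function of the real variable [t]. *)
Lemma diff_transport (F : V -> R) x y h k : differentiable F x ->
  differentiable F y ->
  (forall t : R, F (x + t *: h) = F (y + t *: k)) -> 'd F x h = 'd F y k.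
Proof.
move=> dx dy FE; rewrite -!deriveE// /derive.
set f := (X in lim (X @ _)); set g := (X in _ = lim (X @ _)).
suff -> : f = g by [].
apply/funext => t; rewrite /f /g /=.
by have := FE 0; rewrite !scale0r !addr0 => ->; rewrite [_ + x]addrC FE [_ + y]addrC.
Qed.

(** Differentiating in [t] equates the first derivatives for every [s]. Their increments from 0 to a
    small [s] are [s] times the two Hessian values, up to an arbitrarily small multiple of [s];
    divide by [s]. *)
Lemma hess_transport (alpha : R) (F : V -> R) x y h k h' k' :
  C2alpha_loc alpha F ->
  (forall s t : R, F (x + s *: h + t *: k) = F (y + s *: h' + t *: k')) ->
  hess F x h k = hess F y h' k'.
Proof.
move=> cF FE.
have dE (s : R) : 'd F (x + s *: h) k = 'd F (y + s *: h') k'.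
  by apply: diff_transport => [||t]; [exact: C2_diff cF _|exact: C2_diff cF _|].
have d0E : 'd F x k = 'd F y k'.
  by have := dE 0; rewrite !scale0r !addr0.
apply/eqP; rewrite -subr_eq0 -normr_eq0 eq_le normr_ge0 andbT.
set c := `|h| * `|k| + `|h'| * `|k'|.
have c0 : 0 <= c by rewrite addr_ge0// mulr_ge0.
apply/ler_addgt0Pl => e e0; rewrite addr0.
(* The two remainders add up to [s * (e / (c + 1)) * c], at most [s * e]; the [+ 1] covers
   [c = 0]. *)
have e'0 : 0 < e / (c + 1) by rewrite divr_gt0// ltr_wpDl.
have [s s0 [/(_ k) H1 /(_ k') H2]] :=
  small_scale h h' (C2_diff2 cF x e'0) (C2_diff2 cF y e'0).
move: H1 H2; rewrite dE d0E !normrZ (ger0_norm (ltW s0)).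
have -> : hess F x (s *: h) k = s * hess F x h k by rewrite /hess linearZ.
have -> : hess F y (s *: h') k' = s * hess F y h' k' by rewrite /hess linearZ.
set a := hess F x h k; set b := hess F y h' k'.
set D := 'd F (y + s *: h') k' - 'd F y k' => H1 H2.
have : s * `|a - b| <= s * (e / (c + 1) * c).
  rewrite -{1}(ger0_norm (ltW s0)) -normrM.
  rewrite (_ : s * (a - b) = (D - s * b) - (D - s * a)); last by ring.
  apply: (le_trans (ler_normB _ _)).
  apply: le_trans (lerD H2 H1) _.
  by rewrite /c le_eqVlt; apply/orP; left; apply/eqP; ring.
rewrite ler_pM2l// => /le_trans; apply.
rewrite mulrAC ler_pdivrMr ?ltr_wpDl//.
by apply: ler_wpM2l; [exact: ltW|rewrite lerDl].
Qed.
End hess_transport.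

(** * Lebesgue measure on the cube has no atoms *)

Section cube_nonatomic.
Variables (R : realType) (n : nat).
Local Notation P := (cube R n.+1).
Local Notation T := (n.+1.-tuple (measurableTypeR R)).
Local Notation coord := (fun t : T => tnth t ord0).

Lemma measurable_coord (S : set (measurableTypeR R)) : measurable S ->
  measurable (coord @^-1` S).
Proof. by move=> mS; rewrite -[X in measurable X]setTI; exact: measurable_tnth. Qed.

Lemma cube_coord (S : set (measurableTypeR R)) : measurable S ->
  P (coord @^-1` S) = unit_itv S.
Proof.
move=> mS; pose A (i : 'I_n.+1) := if i == ord0 then S else setT.
have mA i : measurable (A i) by rewrite /A; case: ifP.
have := cube_box mA; rewrite big_ord_recl big1; last first.
  by move=> i _; rewrite /A/=; exact: unit_itv_setT.
rewrite mule1 /A eqxx => <-; congr (P _).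
apply/seteqP; split=> t /=; first by move=> St i; case: eqP => // ->.
by move/(_ ord0); rewrite eqxx.
Qed.

Lemma cube_slice_le (E : set T) (S : set (measurableTypeR R)) :
  measurable E -> measurable S -> (P (E `&` coord @^-1` S) <= unit_itv S)%E.
Proof.
move=> mE mS; rewrite -cube_coord//; have mcS := measurable_coord mS.
by rewrite le_measure ?inE//; exact: measurableI.
Qed.

(** The part of [E] where the first coordinate is below [s] has a measure that depends on [s] in a
    nondecreasing, 1-Lipschitz way and grows from 0 at [s = 0] to [P E] at [s = 1]. The intermediate
    value theorem finds the slice of measure [eps]. *)
Lemma cube_subsetS (E : set T) (eps : R) : measurable E ->
  0 <= eps -> (eps%:E <= P E)%E ->
  exists A, [/\ measurable A, A `<=` E & P A = eps%:E].
Proof.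
move=> mE e0 eE.
pose slice (s : R) : set T := E `&` coord @^-1` [set` `]-oo, s[].
have mS (s : R) : measurable (slice s).
  by apply: measurableI => //; apply: measurable_coord; exact: measurable_itv.
pose phi s := fine (P (slice s)).
have phiE s : P (slice s) = (phi s)%:E by rewrite fineK// fin_num_measure.
have phiD s s' : s <= s' -> phi s <= phi s' <= phi s + (s' - s).
  move=> ss'; apply/andP; split.
    rewrite -lee_fin -!phiE le_measure ?inE// => t [Et /=].
    by rewrite !in_itv/= => ts; split=> //=; rewrite in_itv/= (lt_le_trans ts).
  have mI : measurable ([set` `[s, s'[] : set (measurableTypeR R)) by exact: measurable_itv.
  have sE : slice s' `<=` slice s `|` (E `&` coord @^-1` [set` `[s, s'[]).
    move=> t [Et /=]; rewrite !in_itv/= => ts'.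
    have [ts|ts] := ltP (tnth t ord0) s; first by left; split=> //=; rewrite in_itv.
    by right; split=> //=; rewrite in_itv/= ts.
  rewrite -lee_fin EFinD -!phiE.
  have mES : measurable (E `&` coord @^-1` [set` `[s, s'[]).
    by apply: measurableI => //; exact: measurable_coord.
  apply: (@le_trans _ _ (P (slice s `|` (E `&` coord @^-1` [set` `[s, s'[])))).
    by rewrite le_measure ?inE//; exact: measurableU.
  apply: (le_trans (measureU2 _ _ _)) => //; apply: leeD2l.
  apply: (le_trans (cube_slice_le mE mI)).
  rewrite /unit_itv /mrestr.
  apply: (@le_trans _ _ (lebesgue_measure ([set` `[s, s'[] : set (measurableTypeR R)))).
    by rewrite le_measure ?inE//; apply: measurableI => //; exact: measurable_itv.
  by rewrite lebesgue_measure_itv/= lte_fin; case: ifPn => //; rewrite lee_fin subr_ge0.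
have cphi : continuous phi.
  move=> s; apply/cvgrPdist_le => e e1; near=> t.
  have st : `|s - t| <= e by near: t; exact: cvgr_dist_le.
  move: st; rewrite !ler_norml => /andP[st1 st2].
  have [ts|/ltW ts] := leP s t; have /andP[H1 H2] := phiD _ _ ts.
    by apply/andP; split; lra.
  by apply/andP; split; lra.
have phi0 : phi 0 = 0.
  apply/eqP; rewrite eq_le fine_ge0// andbT -lee_fin -phiE.
  apply: (le_trans (cube_slice_le mE _)); first exact: measurable_itv.
  rewrite /unit_itv /mrestr (_ : _ `&` _ = set0) ?measure0//.
  by apply/seteqP; split=> // r /= []; rewrite !in_itv/= => r0 /andP[r1 _]; lra.
(* What the slice at 1 misses lies where the first coordinate is at least 1, outside the open unit
   interval, hence in a null set. *)
have phi1 : (phi 1)%:E = P E.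
  rewrite -phiE; apply/eqP; rewrite eq_le; apply/andP; split.
    by rewrite le_measure ?inE// => t [].
  have mI : measurable ([set` `[1, +oo[] : set (measurableTypeR R)) by exact: measurable_itv.
  have mES : measurable (E `&` coord @^-1` [set` `[1, +oo[]).
    by apply: measurableI => //; exact: measurable_coord.
  apply: (@le_trans _ _ (P (slice 1 `|` (E `&` coord @^-1` [set` `[1, +oo[])))).
    rewrite le_measure ?inE//; first exact: measurableU.
    move=> t Et; have [t1|t1] := ltP (tnth t ord0) 1.
      by left; split=> //=; rewrite in_itv.
    by right; split=> //=; rewrite in_itv/= t1.
  apply: (le_trans (measureU2 _ _ _)) => //; rewrite -[leRHS]adde0.
  apply: leeD2l; apply: (le_trans (cube_slice_le mE mI)).
  rewrite /unit_itv /mrestr (_ : _ `&` _ = set0) ?measure0//.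
  by apply/seteqP; split=> // r /= []; rewrite !in_itv/= andbT => r0 /andP[_ r1]; lra.
have [||s _ sE] := @IVT R phi 0 1 eps ler01; last 1 first.
- by exists (slice s); split=> //; [move=> t []|rewrite phiE sE].
- exact: continuous_subspaceT.
- move: eE; rewrite -phi1 lee_fin => eE.
  have p0 := le_trans e0 eE.
  by rewrite phi0 min_l// max_r// e0 eE.
Unshelve. all: by end_near.
Qed.
End cube_nonatomic.

(** In dimension 0 [cube] is a Dirac mass, with no set of measure strictly between 0 and 1; hence
    the condition on [d]. *)
Lemma cube_subset (R : realType) (d : nat)
    (E : set (d.-tuple (measurableTypeR R))) (eps : R) : (0 < d)%N ->
  measurable E -> 0 <= eps -> (eps%:E <= cube R d E)%E ->
  exists A, [/\ measurable A, A `<=` E & cube R d A = eps%:E].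
Proof. by case: d E => // n E _; exact: cube_subsetS. Qed.

(** * Vanishing of the Wasserstein distance on the diagonal *)

Section wasserstein_refl.
Variables (R : realType) (d : nat).
Local Notation Rd := 'rV[R]_d.

Lemma measurable_coord_rV (i : 'I_d) :
  measurable_fun [set: Rd] (fun q : Rd => q 0 i).
Proof.
apply: (measurability _ (RGenOpens.measurableE R)).
move=> _ [_ [a [b ->]] <-]; rewrite setTI; apply: open_measurable_rV.
apply: open_comp; last exact: interval_open.
by move=> q _; exact: coord_continuous.
Qed.

Lemma measurable_dotv_sub :
  measurable_fun [set: Rd * Rd] (fun z => dotv (z.1 - z.2) (z.1 - z.2)).
Proof.
apply: measurable_sum => i.
have mD : measurable_fun [set: Rd * Rd] (fun z => (z.1 - z.2) 0 i).
  under eq_fun do rewrite !mxE.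
  apply: measurable_funB.
    exact: (measurableT_comp (measurable_coord_rV i) measurable_fst).
  exact: (measurableT_comp (measurable_coord_rV i) measurable_snd).
exact: measurable_funM.
Qed.

Definition diagonal_map (q : Rd) : Rd * Rd := (q, q).

Lemma measurable_diagonal_map : measurable_fun [set: Rd] diagonal_map.
Proof. exact: measurable_fun_pair. Qed.

HB.instance Definition _ :=
  isMeasurableFun.Build _ _ _ _ diagonal_map measurable_diagonal_map.

(** The diagonal coupling costs nothing. This lets the joint continuity in measure and point be used
    at a fixed measure. *)
Lemma W2_refl (mu : P2 R d) : W2 mu mu = 0.
Proof.
suff -> : W2 mu mu = Num.sqrt (fine 0%E) by rewrite sqrtr0.
rewrite /W2; congr (Num.sqrt (fine _)).
have dot0 (u : Rd) : 0 <= dotv u u.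
  by apply: sumr_ge0 => i _; rewrite -expr2 sqr_ge0.
apply/eqP; rewrite eq_le; apply/andP; split; last first.
  by apply: le_ereal_inf_tmp => _ [g _ <-]; apply: integral_ge0 => z _; rewrite lee_fin.
apply: ereal_inf_lbound; exists (distribution mu diagonal_map).
  by move=> A mA; split.
rewrite /cost ge0_integral_distribution//; last first.
- by move=> z; rewrite lee_fin.
- by apply/measurable_EFinP; exact: measurable_dotv_sub.
rewrite integral0_eq// => q _ /=.
by rewrite subrr /dotv big1// => i _; rewrite mxE mul0r.
Qed.
End wasserstein_refl.

(** * Integrals of functions close to a multiple of an indicator *)

Section integral_estimates.
Context {dT} {T : measurableType dT} {R : realType}.

(** The almost everywhere bound makes [f] vanish on [D] outside [A] and stay within [eta] of [c] on
    [A]. It will serve for the single integral with [c] a Jacobian entry, and for the double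
    integral with [c = 0]. *)
Lemma Rintegral_dist_indic (mu : {measure set T -> \bar R}) (D A : set T)
    (f : T -> R) (c eta : R) : 0 <= eta ->
  measurable D -> measurable A -> A `<=` D -> (mu A < +oo)%E ->
  mu.-integrable D (EFin \o f) ->
  {ae mu, forall w, D w -> `|f w - c * \1_A w| <= eta * \1_A w} ->
  `|\int[mu]_(w in D) f w - c * fine (mu A)| <= eta * fine (mu A).
Proof.
move=> eta0 mD mA AD muA intf fA.
have intA : mu.-integrable D (EFin \o \1_A).
  apply/integrableP; split; first exact/measurable_EFinP.
  under eq_integral do rewrite /= ger0_norm//.
  by rewrite integral_indic// setIidl.
have RA (a : R) : \int[mu]_(w in D) (a * \1_A w) = a * fine (mu A).
  by rewrite RintegralZl// /Rintegral integral_indic// setIidl.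
have intcA (a : R) : mu.-integrable D (EFin \o (fun w => a * \1_A w)).
  apply: eq_integrable (integrableZl mD a intA) => //.
rewrite -!RA -RintegralB//.
have intB : mu.-integrable D (EFin \o (fun w => f w - c * \1_A w)).
  by apply: eq_integrable (integrableB mD intf (intcA c)).
apply: (le_trans (le_normr_Rintegral mD intB)).
rewrite /Rintegral fine_le//.
- apply: integrable_fin_num => //.
  exact: (integrable_abse intB).
- by apply: integrable_fin_num => //; exact: intcA.
apply: ae_ge0_le_integral => //.
- exact: measurable_int (integrable_abse intB).
- by move=> w _; rewrite lee_fin mulr_ge0.
- exact: measurable_int (intcA _).
Qed.

(** If [N] is a null set containing the exceptions, those on the product lie in two null strips, one
    over [N] in each factor. *)
Lemma ae_prod (P : probability T R) (Q : T -> Prop) : {ae P, forall w, Q w} ->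
  {ae (P \x P)%E, forall z, Q z.1 /\ Q z.2}.
Proof.
move=> [N [mN N0 QN]]; exists ((N `*` setT) `|` (setT `*` N)); split.
- by apply: measurableU; exact: measurableX.
- rewrite measureU0; [|exact: measurableX|exact: measurableX|].
    by apply: etrans (product_measure1E P P mN measurableT) _;
       apply: etrans (congr1 (fun y => y * _)%E N0) _; exact: mul0e.
  by apply: etrans (product_measure1E P P measurableT mN) _;
     apply: etrans (congr1 (mule _) N0) _; exact: mule0.
- move=> z /= Qz; have [Q1|Q1] := pselect (Q z.1).
    by right; split=> //; apply: QN => Q2; exact: Qz.
  by left; split=> //; exact: QN.
Qed.
End integral_estimates.

(** * The Hessian on fields carried by a small set near a support point *)

Section hessian_blocks.
Variables (R : realType) (d : nat).
Local Notation P := (cube R d).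
Variables (F : L2 R d -> R) (Phi : P2 R d -> R).
Variables (gradw : P2 R d -> 'rV[R]_d -> 'rV[R]_d).
Variables (hessw : P2 R d -> 'rV[R]_d -> 'rV[R]_d -> 'M[R]_d).
Hypothesis hPhi : C2_P2 Phi gradw hessw.
Variables (x : L2 R d) (mu : P2 R d).
Hypothesis hx : has_law x mu.
Hypothesis hid : hess_identity F gradw hessw x mu.
Local Notation X := (L2_fun x).

Lemma mx_entry_norm m n (M : 'M[R]_(m, n)) i j : `|M i j| <= `|M|.
Proof.
rewrite [leRHS]mx_normrE; exact: (le_bigmax _ (fun ij => `|M ij.1 ij.2|) (i, j)).
Qed.

Lemma mx_entry_dist m n (M N : 'M[R]_(m, n)) i j : `|M i j - N i j| <= `|M - N|.
Proof. by have := mx_entry_norm (M - N) i j; rewrite !mxE. Qed.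

Lemma dotv_delta (M : 'M[R]_d) i j (a b : R) :
  dotv ((a *: delta_mx 0 i) *m M) (b *: delta_mx 0 j) = a * b * M i j.
Proof.
rewrite -scalemxAl -rowE /dotv (bigD1 j)//= big1 ?addr0.
  by rewrite !mxE !eqxx mulr1; ring.
by move=> k kj; rewrite !mxE eqxx (negbTE kj) /= !mulr0.
Qed.

(** On such fields the single integral runs over [A], where the Jacobian is within [eta] of its
    value at [q]. The double integral runs over the square of [A], where the Wasserstein Hessian is
    bounded, so it is quadratic in the measure of [A]. *)
Lemma hess_block q i j (eta : R) : spt mu q -> 0 < eta ->
  exists delta M : R, [/\ 0 < delta, 0 <= M & forall A h k,
    measurable A -> A `<=` X @^-1` ball q delta -> A `<=` X @^-1` spt mu ->
    {ae P, forall w, L2_fun h w = \1_A w *: delta_mx 0 i} ->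
    {ae P, forall w, L2_fun k w = \1_A w *: delta_mx 0 j} ->
    `|hess F x h k - jacobian (gradw mu) q i j * fine (P A)|
      <= eta * fine (P A) + M * fine (P A) ^+ 2].
Proof.
move=> sq eta0.
have [d1 d10 J] := C2_Dq_cont hPhi sq eta0.
have [d2 d20 W] := C2_hessw_cont hPhi sq sq (@ltr01 R).
(* Continuity of the Wasserstein Hessian at the pair [(q, q)] with tolerance 1 gives the bound
   [M]. *)
exists (Num.min d1 d2), (`|hessw mu q q| + 1); split.
- by rewrite lt_min d10.
- by rewrite addr_ge0.
have m0 : 0 < Num.min d1 d2 by rewrite lt_min d10.
move=> A h k mA Aq As hA kA.
have [intf intg ->] := hid h k.
set D := X @^-1` spt mu.
have mD : measurable D.
  apply: (measurable_preimage_spt (P := P)); first exact: measurable_L2_fun.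
  exact: hx.
have near_q w : A w -> `|X w - q| < d1 /\ `|X w - q| < d2.
  move=> /Aq; rewrite /= mx_norm_ball /ball_/= distrC => H.
  by move: H; rewrite lt_min => /andP[].
have fA1 : (P A < +oo)%E by rewrite ltey_eq fin_num_measure.
have PPA : (P \x P)%E (A `*` A) = (P A * P A)%E by rewrite product_measure1E.
have fPP : ((P \x P)%E (A `*` A) < +oo)%E.
  by rewrite PPA ltey_eq fin_numM// fin_num_measure.
rewrite addrAC; apply: (le_trans (ler_normD _ _)); apply: lerD.
  apply: Rintegral_dist_indic => //; first exact: ltW.
  move: hA kA; apply: filterS2 => w -> -> Dw; rewrite dotv_delta indicE.
  have [wA|wA] := boolP (w \in A); last by rewrite !mul0r !mulr0 subr0 normr0.
  rewrite !mul1r !mulr1; move/set_mem : wA => wA.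
  have := J mu (X w) Dw; rewrite W2_refl => /(_ d10 (near_q _ wA).1) /ltW.
  by apply: le_trans; exact: mx_entry_dist.
(* The double integral is put in the form needed for comparison with the constant 0. *)
rewrite -[X in `|X|]subr0 -[X in _ - X](mul0r (fine ((P \x P)%E (A `*` A)))).
have -> : fine (P A) ^+ 2 = fine ((P \x P)%E (A `*` A)).
  by rewrite PPA fineM// fin_num_measure.
apply: Rintegral_dist_indic => //.
- exact: measurableX.
- exact: measurableX.
- by move=> z [Az1 Az2]; split; exact: As.
have hk : {ae P, forall w, L2_fun h w = \1_A w *: delta_mx 0 i /\
    L2_fun k w = \1_A w *: delta_mx 0 j}.
  by move: hA kA; apply: filterS2.
move: (ae_prod hk); apply: filterS => -[w w'] /= [[-> _] [_ ->]] [Dw Dw'].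
rewrite dotv_delta mul0r subr0 !indicE in_setX/=.
have [wA|wA] := boolP (w \in A); last by rewrite !mul0r mulr0 normr0.
have [w'A|w'A] := boolP (w' \in A); last by rewrite mulr0 mul0r mulr0 normr0.
rewrite !mul1r mulr1; move/set_mem : wA => wA; move/set_mem : w'A => w'A.
apply: le_trans (mx_entry_norm _ i j) _.
have := W mu (X w) (X w') Dw Dw'.
rewrite W2_refl => /(_ d20 (near_q _ wA).2 (near_q _ w'A).2) /ltW H.
rewrite -[X in `|X|](subrK (hessw mu q q)) addrC.
by apply: (le_trans (ler_normD _ _)); rewrite lerD2l.
Qed.
End hessian_blocks.

(** * Maps made constant on two disjoint patches, and the swap of the constants *)

Section swapping_patches.
Variables (R : realType) (d : nat).
Local Notation P := (cube R d).
Local Notation T := (d.-tuple (measurableTypeR R)).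
Local Notation Rd := 'rV[R]_d.
Variables (x : L2 R d) (A1 A2 : set T).
Hypotheses (mA1 : measurable A1) (mA2 : measurable A2).
Hypothesis A12 : forall w, A1 w -> ~ A2 w.
Local Notation X := (L2_fun x).

(** Written with indicators rather than by cases, so that coordinates are measurable as sums of
    products. *)
Definition patched (a b : Rd) (w : T) : Rd :=
  \1_A1 w *: a + \1_A2 w *: b + \1_(~` (A1 `|` A2)) w *: X w.

Lemma patched1 a b w : A1 w -> patched a b w = a.
Proof.
move=> A1w; rewrite /patched !indicE (mem_set A1w) (memNset (A12 A1w)) memNset.
  by rewrite scale1r !scale0r !addr0.
by apply; left.
Qed.

Lemma patched2 a b w : A2 w -> patched a b w = b.
Proof.
move=> A2w; have A1w : ~ A1 w by move=> /A12.
rewrite /patched !indicE (mem_set A2w) (memNset A1w) memNset.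
  by rewrite scale1r !scale0r add0r addr0.
by apply; right.
Qed.

Lemma patchedC a b w : ~ A1 w -> ~ A2 w -> patched a b w = X w.
Proof.
move=> A1w A2w; rewrite /patched !indicE (memNset A1w) (memNset A2w) mem_set.
  by rewrite scale1r !scale0r !add0r.
by case.
Qed.

Lemma measurable_patched a b i :
  measurable_fun [set: T] (fun w => patched a b w 0 i).
Proof.
rewrite /patched; under eq_fun do rewrite !mxE.
have mA : measurable (A1 `|` A2) by exact: measurableU.
apply: measurable_funD; first apply: measurable_funD.
- by apply: measurable_funM => //; exact: measurable_indic.
- by apply: measurable_funM => //; exact: measurable_indic.
- apply: measurable_funM; first by apply: measurable_indic; exact: measurableC.
  have := measurable_L2_fun x i; rewrite /L2_fun.
  by under eq_fun do rewrite mxE.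
Qed.

Lemma patched_preimage a b (B : set Rd) : measurable B ->
  P (patched a b @^-1` B) = (P (A1 `&` cst a @^-1` B) + P (A2 `&` cst b @^-1` B)
    + P (X @^-1` B `\` (A1 `|` A2)))%E.
Proof.
move=> mB.
have mX (f : T -> Rd) : (forall i, measurable_fun [set: T] (fun w => f w 0 i)) ->
    measurable (f @^-1` B).
  by move=> mf; rewrite -[X in measurable X]setTI; apply: measurable_fun_rV.
have mc c : measurable (@cst T Rd c @^-1` B) by apply: mX => i; exact: measurable_cst.
have mXB : measurable (X @^-1` B `\` (A1 `|` A2)).
  apply: measurableD; last exact: measurableU.
  by apply: mX; exact: measurable_L2_fun.
have m1 : measurable (A1 `&` cst a @^-1` B) by exact: measurableI.
have m2 : measurable (A2 `&` cst b @^-1` B) by exact: measurableI.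
rewrite (_ : patched a b @^-1` B = ((A1 `&` cst a @^-1` B) `|`
    (A2 `&` cst b @^-1` B)) `|` (X @^-1` B `\` (A1 `|` A2))); last first.
  apply/seteqP; split=> w /=.
    have [A1w|A1w] := pselect (A1 w); first by rewrite patched1//; left; left.
    have [A2w|A2w] := pselect (A2 w); first by rewrite patched2//; left; right.
    by rewrite patchedC// => Bw; right; split=> // -[].
  move=> [[[A1w ?]|[A2w ?]]|[? /not_orP[? ?]]].
  - by rewrite patched1.
  - by rewrite patched2.
  - by rewrite patchedC.
rewrite measureU//; last 2 first.
- exact: measurableU.
- by apply/seteqP; split=> // w [[[? _]|[? _]] [_]]; apply; [left|right].
rewrite measureU//.
by apply/seteqP; split=> // w [[/A12 ? _] [? _]].
Qed.

(** Preimages split over the two patches and the rest. A constant contributes the whole measure of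
    its patch or nothing, so with patches of equal measure the law does not see which constant sits
    on which patch. *)
Lemma patched_swap a b (F : L2 R d -> R) (u v : L2 R d) :
  rearrangement_invariant F -> P A1 = P A2 ->
  {ae P, forall w, L2_fun u w = patched a b w} ->
  {ae P, forall w, L2_fun v w = patched b a w} -> F u = F v.
Proof.
move=> Finv PA uE vE; apply: Finv => B mB.
rewrite (law_ae (measurable_patched a b) mB uE).
rewrite (law_ae (measurable_patched b a) mB vE).
have cstE c : P (A1 `&` cst c @^-1` B) = P (A2 `&` cst c @^-1` B).
  have [cB|cB] := pselect (B c).
    rewrite (_ : cst c @^-1` B = setT) ?setIT//.
    by apply/seteqP; split.
  rewrite (_ : cst c @^-1` B = set0) ?setI0//.
  by apply/seteqP; split.
apply: etrans (patched_preimage a b mB) _.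
apply: etrans _ (esym (patched_preimage b a mB)).
by rewrite !cstE [in RHS](addeC (P (A2 `&` cst b @^-1` B))).
Qed.

(** The change to [x] is bounded by [K] and carried by the patches, so its L^2 norm is small once
    they have small measure, however far apart [a] and [b] are. *)
Lemma patched_near a b (K : R) : 0 <= K ->
  (forall w, A1 w -> `|a - X w| <= K) -> (forall w, A2 w -> `|b - X w| <= K) ->
  exists y, {ae P, forall w, L2_fun y w = patched a b w} /\
    `|x - y| <= Num.sqrt d%:R * K * Num.sqrt (fine (P (A1 `|` A2))).
Proof.
move=> K0 aK bK; have mA : measurable (A1 `|` A2) by exact: measurableU.
have [||u [uE uK]] := @L2_of_bounded R d (fun w => patched a b w - X w) _ K K0 mA.
- move=> i.
  rewrite (_ : (fun w => _) = (fun w => patched a b w 0 i) \- (fun w => X w 0 i)).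
    by apply: measurable_funB; [exact: measurable_patched|exact: measurable_L2_fun].
  by apply/funext => w; rewrite mxE [X in _ + X = _]mxE.
- move=> w i; apply: le_trans (mx_entry_norm _ _ _) _; rewrite indicE.
  have [A1w|A1w] := pselect (A1 w).
    by rewrite patched1// mem_set ?mulr1; [exact: aK|left].
  have [A2w|A2w] := pselect (A2 w).
    by rewrite patched2// mem_set ?mulr1; [exact: bK|right].
  by rewrite patchedC// subrr normr0 mulr_ge0.
exists (x + u); split; last by rewrite opprD addNKr normrN.
by move: (L2_funD x u) uE; apply: filterS2 => w -> ->; rewrite addrC subrK.
Qed.
End swapping_patches.

(** A ball about a support point has a preimage of positive measure, and nonatomicity yields subsets
    of it of every smaller measure. Having all [eps] up to [p] allows a common [eps] for two
    points. *)
Lemma cube_patch (R : realType) (d : nat) (hd : (0 < d)%N) (x : L2 R d)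
    (mu : P2 R d) (q : 'rV[R]_d) (delta : R) : has_law x mu -> spt mu q ->
  0 < delta -> exists2 p : R, 0 < p & forall eps, 0 <= eps <= p ->
    exists A, [/\ measurable A, A `<=` L2_fun x @^-1` ball q delta,
      A `<=` L2_fun x @^-1` spt mu & cube R d A = eps%:E].
Proof.
move=> hx sq delta0; set X := L2_fun x.
have mD : measurable (X @^-1` spt mu).
  apply: (measurable_preimage_spt (P := cube R d)); last exact: hx.
  exact: measurable_L2_fun.
have mB : measurable (X @^-1` ball q delta).
  by apply: measurable_preimage_ball => //; exact: measurable_L2_fun.
have mBD := measurableI _ _ mB mD.
have PBD : (0 < cube R d (X @^-1` ball q delta `&` X @^-1` spt mu))%E.
  have oB : open (ball q delta) by exact: ball_open.
  have := sq _ oB (ballxx _ delta0); rewrite hx; last exact: open_measurable_rV.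
  rewrite [law x _](_ : _ = cube R d (X @^-1` ball q delta))//.
  move=> /lt_le_trans; apply.
  (* Restricting to the preimage of the support costs nothing, its complement being null. *)
  apply: (@le_trans _ _ (cube R d
      ((X @^-1` ball q delta `&` X @^-1` spt mu) `|` ~` (X @^-1` spt mu)))).
    rewrite le_measure ?inE//.
      by apply: measurableU => //; exact: measurableC.
    by move=> w Bw; have [?|?] := pselect ((X @^-1` spt mu) w); [left|right].
  rewrite measureU0//; first exact: measurableC.
  by apply: preimage_sptC0; [exact: measurable_L2_fun|exact: hx].
have fin : cube R d (X @^-1` ball q delta `&` X @^-1` spt mu) \is a fin_num.
  exact: fin_num_measure.
exists (fine (cube R d (X @^-1` ball q delta `&` X @^-1` spt mu))).
  by rewrite fine_gt0// PBD ltey_eq fin.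
move=> eps /andP[e0 ep].
have [|A [mA AE PA]] := cube_subset hd mBD e0; first by rewrite -(fineK fin) lee_fin.
by exists A; split=> // w /AE[].
Qed.

(** In the application [a1], [a2] are the Hessian values at [x] on the two patches and [b] is the
    value shared by the two patched maps. Of the factor 3, two units come from the block estimates
    and one from the quadratic errors; [2 * n] comes from the two comparisons with [b]. *)
Lemma block_comparison (R : realFieldType) (a1 a2 b c1 c2 n eta M1 M2 eps : R) :
  0 < eps -> (M1 + M2 + 1) * eps <= eta ->
  `|a1 - c1 * eps| <= eta * eps + M1 * eps ^+ 2 ->
  `|b - a1| <= eta * n * eps -> `|b - a2| <= eta * n * eps ->
  `|a2 - c2 * eps| <= eta * eps + M2 * eps ^+ 2 ->
  `|c1 - c2| <= (3 + 2 * n) * eta.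
Proof.
move=> eps0 epsM E1 D1 D2 E2.
rewrite -(ler_pM2r eps0) -{1}[eps](ger0_norm (ltW eps0)) -normrM.
have epsMM : (M1 + M2) * eps ^+ 2 <= eta * eps.
  rewrite expr2 mulrA ler_pM2r//; apply: le_trans epsM.
  by rewrite ler_pM2r// lerDl.
have -> : (c1 - c2) * eps = - (a1 - c1 * eps) - (b - a1) + (b - a2)
    + (a2 - c2 * eps) by ring.
apply: (le_trans (ler_normD _ _)); apply: le_trans (lerD _ E2) _.
  apply: (le_trans (ler_normD _ _)); apply: (lerD _ D2).
  apply: (le_trans (ler_normD _ _)); rewrite !normrN; exact: (lerD E1 D1).
rewrite (_ : (3 + 2 * n) * eta * eps
    = 2 * eta * eps + 2 * (eta * n * eps) + eta * eps); last by ring.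
lra.
Qed.

(** * Comparison of the Jacobian at two points of the support *)

Section jacobian_constant.
Variables (R : realType) (d : nat) (alpha : R) (F : L2 R d -> R).
Hypotheses (hF : C2alpha_loc alpha F) (Finv : rearrangement_invariant F).
Local Notation P := (cube R d).
Local Notation T := (d.-tuple (measurableTypeR R)).
Local Notation e_ i := (delta_mx 0 i : 'rV[R]_d).

Lemma indicator_field (A : set T) (i : 'I_d) : measurable A ->
  exists h : L2 R d, {ae P, forall w, L2_fun h w = \1_A w *: e_ i} /\
    `|h| <= Num.sqrt d%:R * Num.sqrt (fine (P A)).
Proof.
move=> mA.
have [||h [hE hn]] := @L2_of_bounded R d (fun w => \1_A w *: e_ i) A 1 ler01 mA.
- move=> k; under eq_fun do rewrite mxE.
  by apply: measurable_funM => //; exact: measurable_indic.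
- move=> w k; rewrite !mxE mul1r normrM ger0_norm// ler_piMr//.
  by rewrite eqxx /=; case: (k == i); rewrite ?normr1 ?normr0.
by exists h; split=> //; rewrite mulr1 in hn.
Qed.

(** Moving [y1] along its two fields only replaces the constant [q1] on [A1] by
    [q1 + s *: e_ i + t *: e_ j]; moving [y2] does the same to [q1] on [A2]. The moved maps still
    differ by a swap, so [F] agrees on them for all [s] and [t]. *)
Lemma patched_hess (x : L2 R d) (A1 A2 : set T) (q1 q2 : 'rV[R]_d) i j
    (y1 y2 h1 k1 h2 k2 : L2 R d) :
  measurable A1 -> measurable A2 -> (forall w, A1 w -> ~ A2 w) -> P A1 = P A2 ->
  {ae P, forall w, L2_fun y1 w = patched x A1 A2 q1 q2 w} ->
  {ae P, forall w, L2_fun y2 w = patched x A1 A2 q2 q1 w} ->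
  {ae P, forall w, L2_fun h1 w = \1_A1 w *: e_ i} ->
  {ae P, forall w, L2_fun k1 w = \1_A1 w *: e_ j} ->
  {ae P, forall w, L2_fun h2 w = \1_A2 w *: e_ i} ->
  {ae P, forall w, L2_fun k2 w = \1_A2 w *: e_ j} ->
  hess F y1 h1 k1 = hess F y2 h2 k2.
Proof.
move=> mA1 mA2 A12 PA y1E y2E h1E k1E h2E k2E.
apply: (hess_transport hF) => s t.
have shift_in (A : set T) w (v : 'rV[R]_d) : A w ->
    v + s *: (\1_A w *: e_ i) + t *: (\1_A w *: e_ j) = v + s *: e_ i + t *: e_ j.
  by move=> Aw; rewrite indicE mem_set// !scale1r.
have shift_out (A : set T) w (v : 'rV[R]_d) : ~ A w ->
    v + s *: (\1_A w *: e_ i) + t *: (\1_A w *: e_ j) = v.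
  by move=> Aw; rewrite indicE memNset// !scale0r !scaler0 !addr0.
have combE (y h k : L2 R d) : {ae P, forall w,
    L2_fun (y + s *: h + t *: k) w
    = L2_fun y w + s *: L2_fun h w + t *: L2_fun k w}.
  have : {ae P, forall w, L2_fun (y + s *: h + t *: k) w
      = L2_fun y w + L2_fun (s *: h) w + L2_fun (t *: k) w}.
    move: (L2_funD (y + s *: h) (t *: k)) (L2_funD y (s *: h)).
    by apply: filterS2 => w E1 E2; exact: etrans E1 (congr1 (+%R^~ _) E2).
  move: (L2_funZ s h) (L2_funZ t k).
  apply: filterS3 => w Eh Ek E; apply: etrans E _.
  by congr (_ + _ + _).
pose a := q1 + s *: e_ i + t *: e_ j.
apply: (patched_swap mA1 mA2 A12 (a := a) (b := q2) Finv PA).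
  have comb' : {ae P, forall w, L2_fun (y1 + s *: h1 + t *: k1) w
      = L2_fun y1 w + s *: (\1_A1 w *: e_ i) + t *: (\1_A1 w *: e_ j)}.
    move: h1E k1E (combE y1 h1 k1); apply: filterS3 => w Eh Ek E.
    by apply: etrans E _; rewrite Eh Ek.
  move: y1E comb'; apply: filterS2 => w yw E; apply: etrans E _; rewrite yw.
  have [A1w|A1w] := pselect (A1 w).
    by apply: etrans (shift_in _ _ _ A1w) _; rewrite !patched1.
  apply: etrans (shift_out _ _ _ A1w) _.
  have [A2w|A2w] := pselect (A2 w); first by rewrite !patched2.
  by rewrite !patchedC.
have comb' : {ae P, forall w, L2_fun (y2 + s *: h2 + t *: k2) w
    = L2_fun y2 w + s *: (\1_A2 w *: e_ i) + t *: (\1_A2 w *: e_ j)}.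
  move: h2E k2E (combE y2 h2 k2); apply: filterS3 => w Eh Ek E.
  by apply: etrans E _; rewrite Eh Ek.
move: y2E comb'; apply: filterS2 => w yw E; apply: etrans E _; rewrite yw.
have [A2w|A2w] := pselect (A2 w).
  by apply: etrans (shift_in _ _ _ A2w) _; rewrite !patched2.
apply: etrans (shift_out _ _ _ A2w) _.
have [A1w|A1w] := pselect (A1 w); first by rewrite !patched1.
by rewrite !patchedC.
Qed.

Variables (Phi : P2 R d -> R).
Variables (gradw : P2 R d -> 'rV[R]_d -> 'rV[R]_d).
Variables (hessw : P2 R d -> 'rV[R]_d -> 'rV[R]_d -> 'M[R]_d).
Hypothesis hPhi : C2_P2 Phi gradw hessw.
Variables (x : L2 R d) (mu : P2 R d).
Hypothesis hx : has_law x mu.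
Hypothesis hid : hess_identity F gradw hessw x mu.
Hypothesis hd : (0 < d)%N.
Local Notation X := (L2_fun x).
Local Notation J := (jacobian (gradw mu)).

Lemma jacobian_near q1 q2 i j (eta : R) : spt mu q1 -> spt mu q2 -> q1 != q2 ->
  0 < eta -> `|J q1 i j - J q2 i j| <= (3 + 2 * d%:R) * eta.
Proof.
move=> s1 s2 q12 eta0.
have [dl1 [M1 [dl10 M10 B1]]] := hess_block hPhi hx hid i j s1 eta0.
have [dl2 [M2 [dl20 M20 B2]]] := hess_block hPhi hx hid i j s2 eta0.
have /nbhs_normP[rho /= rho0 contF] := C2_continuous hF x eta0.
have dist0 : 0 < `|q1 - q2| by rewrite normr_gt0 subr_eq0.
(* The first two bounds serve the block estimates, the bound 1 serves [K], and half the distance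
   makes the patches disjoint. *)
pose dl := Num.min (Num.min dl1 dl2) (Num.min 1 (`|q1 - q2| / 2)).
have dl0 : 0 < dl by rewrite !lt_min dl10 dl20 ltr01 divr_gt0.
have dll1 : dl <= dl1 by rewrite !ge_min lexx.
have dll2 : dl <= dl2 by rewrite !ge_min lexx !orbT.
have dl_1 : dl <= 1 by rewrite !ge_min lexx !orbT.
have dl_q : dl <= `|q1 - q2| / 2 by rewrite !ge_min lexx !orbT.
have [p1 p10 C1] := cube_patch hd hx s1 dl0.
have [p2 p20 C2] := cube_patch hd hx s2 dl0.
(* Bounds the change on a patch even with swapped constants: the distance between the points, plus
   at most [dl]. *)
pose K := `|q1 - q2| + 1.
have K0 : 0 < K by rewrite addr_gt0.
pose S := Num.sqrt (d%:R : R).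
have S0 : 0 <= S by exact: sqrtr_ge0.
have SK0 : 0 <= S * K by rewrite mulr_ge0// ltW.
(* Ensures [S * K * r < rho], so patches of total measure at most [r ^+ 2] keep the patched maps
   within [rho] of [x]. *)
pose r := rho / (S * K + 1).
have r0 : 0 < r by rewrite divr_gt0// ltr_wpDl.
(* Both patches exist at this measure, the quadratic errors are absorbed by [eta], and the union has
   measure at most [r ^+ 2]. *)
pose eps := Num.min (Num.min p1 p2)
  (Num.min (eta / (M1 + M2 + 1)) (r ^+ 2 / 2)).
have eps0 : 0 < eps.
  by rewrite !lt_min p10 p20 !divr_gt0// ?exprn_gt0// ltr_wpDl// addr_ge0.
have eps1 : eps <= p1 by rewrite !ge_min lexx.
have eps2 : eps <= p2 by rewrite !ge_min lexx !orbT.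
have epsM : (M1 + M2 + 1) * eps <= eta.
  rewrite mulrC -ler_pdivlMr; last by rewrite ltr_wpDl// addr_ge0.
  by rewrite !ge_min lexx !orbT.
have epsr : 2 * eps <= r ^+ 2.
  by rewrite mulrC -ler_pdivlMr// !ge_min lexx !orbT.
have [|A1 [mA1 A1q A1s PA1]] := C1 eps; first by rewrite ltW.
have [|A2 [mA2 A2q A2s PA2]] := C2 eps; first by rewrite ltW.
have near1 w : A1 w -> `|q1 - X w| < dl.
  by move=> /A1q; rewrite /= mx_norm_ball.
have near2 w : A2 w -> `|q2 - X w| < dl.
  by move=> /A2q; rewrite /= mx_norm_ball.
have A12 w : A1 w -> ~ A2 w.
  move=> /near1 n1 /near2 n2.
  have : `|q1 - q2| <= `|q1 - X w| + `|q2 - X w|.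
    by rewrite (distrC q2) -[q1 - q2](subrKA (X w)) ler_normD.
  by move=> n12; lra.
have PAU : S * K * Num.sqrt (fine (P (A1 `|` A2))) < rho.
  have U2 : fine (P (A1 `|` A2)) <= r ^+ 2.
    apply: le_trans epsr; rewrite -lee_fin fineK ?fin_num_measure//; last first.
      exact: measurableU.
    apply: (le_trans (measureU2 _ _ _)) => //.
    by rewrite [X in (X + _)%E]PA1 [X in (_ + X)%E]PA2 -EFinD lee_fin; lra.
  have : Num.sqrt (fine (P (A1 `|` A2))) <= r.
    by rewrite -[leRHS]ger0_norm ?(ltW r0)// -sqrtr_sqr ler_wsqrtr.
  move=> /(ler_wpM2l SK0) /le_lt_trans; apply.
  rewrite /r mulrA ltr_pdivrMr ?ltr_wpDl// mulrC ltr_pM2l//.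
  by rewrite ltrDl.
have near_K (q q' : 'rV[R]_d) w : `|q - q'| <= `|q1 - q2| -> `|q' - X w| < dl ->
    `|q - X w| <= K.
  move=> qq' q'w; rewrite -[q - _](subrKA q') /K.
  by apply: (le_trans (ler_normD _ _)); apply: lerD => //; lra.
have [|||y1 [y1E y1n]] := @patched_near R d x A1 A2 mA1 mA2 A12 q1 q2 K.
- exact: ltW.
- by move=> w /near1; apply: near_K; rewrite subrr normr0.
- by move=> w /near2; apply: near_K; rewrite subrr normr0.
have [|||y2 [y2E y2n]] := @patched_near R d x A1 A2 mA1 mA2 A12 q2 q1 K.
- exact: ltW.
- by move=> w /near1; apply: near_K; rewrite distrC.
- by move=> w /near2; apply: near_K.
have [h1 [h1E h1n]] := indicator_field i mA1.
have [k1 [k1E k1n]] := indicator_field j mA1.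
have [h2 [h2E h2n]] := indicator_field i mA2.
have [k2 [k2E k2n]] := indicator_field j mA2.
have PA : P A1 = P A2 by rewrite PA1 PA2.
have swapE := patched_hess mA1 mA2 A12 PA y1E y2E h1E k1E h2E k2E.
(* The product of the two norms is of order [eps], the order of the main term of a block, so the
   error survives division by [eps]. *)
have prodn (h k : L2 R d) : `|h| <= S * Num.sqrt eps -> `|k| <= S * Num.sqrt eps ->
    eta * `|h| * `|k| <= eta * d%:R * eps.
  move=> hn kn; rewrite -!mulrA ler_pM2l//.
  have -> : d%:R * eps = (S * Num.sqrt eps) * (S * Num.sqrt eps).
    by rewrite mulrACA -!expr2 !sqr_sqrtr// ltW.
  exact: ler_pM.
rewrite PA1 /= in h1n k1n; rewrite PA2 /= in h2n k2n.
have near_y (y : L2 R d) h k : `|x - y| <= S * K * Num.sqrt (fine (P (A1 `|` A2))) ->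
    `|hess F y h k - hess F x h k| <= eta * `|h| * `|k|.
  by move=> yn; apply: contF; rewrite /ball_ /=; exact: le_lt_trans PAU.
have D1 := le_trans (near_y y1 h1 k1 y1n) (prodn _ _ h1n k1n).
have D2 := le_trans (near_y y2 h2 k2 y2n) (prodn _ _ h2n k2n).
have sub1 : A1 `<=` X @^-1` ball q1 dl1.
  by move=> w /A1q; exact: le_ball.
have sub2 : A2 `<=` X @^-1` ball q2 dl2.
  by move=> w /A2q; exact: le_ball.
have := B1 A1 h1 k1 mA1 sub1 A1s h1E k1E; rewrite PA1 /= => E1.
have := B2 A2 h2 k2 mA2 sub2 A2s h2E k2E; rewrite PA2 /= => E2.
(* The estimates at the two patched maps now share one Hessian value, the [b] of the comparison. *)
rewrite swapE in D1.
exact: (block_comparison eps0 epsM E1 D1 D2 E2).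
Qed.
End jacobian_constant.

Unset Implicit Arguments.

Theorem lemmaA1 (R : realType) (d : nat) (hd : (0 < d)%N)
  (alpha : R) (halpha : 0 < alpha <= 1)
  (F : L2 R d -> R) (hF : C2alpha_loc alpha F)
  (hinv : rearrangement_invariant F)
  (Phi : P2 R d -> R) (hlift : lift_of F Phi)
  (gradw : P2 R d -> 'rV[R]_d -> 'rV[R]_d)
  (hessw : P2 R d -> 'rV[R]_d -> 'rV[R]_d -> 'M[R]_d)
  (hPhi : C2_P2 Phi gradw hessw)
  (x : L2 R d) (mu : P2 R d) (hx : has_law x mu)
  (hid : hess_identity F gradw hessw x mu) :
  forall q1 q2 : 'rV[R]_d, spt mu q1 -> spt mu q2 ->
    jacobian (gradw mu) q1 = jacobian (gradw mu) q2.
Proof.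
move=> q1 q2 s1 s2; have [->//|q12] := eqVneq q1 q2.
apply/matrixP => i j; apply/eqP.
rewrite -subr_eq0 -normr_eq0 eq_le normr_ge0 andbT.
apply/ler_addgt0Pl => e e0; rewrite addr0.
have c0 : 0 < 3 + 2 * d%:R :> R by rewrite ltr_wpDr// mulr_ge0.
(* Taking [eta] to be [e / (3 + 2 * d%:R)] makes the bound exactly [e]. *)
have := jacobian_near hF hinv hPhi hx hid hd i j s1 s2 q12 (divr_gt0 e0 c0).
by rewrite mulrC divfK// gt_eqF.
Qed.
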